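(* For any unsatisfiable CNF formula $F$ on $n$ variables, $\mathrm{depth}_{\mathsf{sCP}}(F\circ\mathrm{XOR}_4^n)\ge\tfrac12\,\mathrm{depth}_{\mathsf{Res}}(F)$.
   Context: $F\circ\mathrm{XOR}_4^n$ is the CNF obtained from $F$ by replacing each variable $z_i$ by $x_{i,1}\oplus x_{i,2}\oplus x_{i,3}\oplus x_{i,4}$ for fresh variables $x_{i,1},\dots,x_{i,4}$ and expanding the result into a CNF in the obvious way. Resolution: a refutation of $F$ is a sequence of clauses ending with the empty clause, each in $F$ or obtained from earlier clauses by resolution ($C\vee\ell$, $D\vee\neg\ell$ yield $C\vee D$) or weakening (from $C$ derive any superset); $\mathrm{depth}_{\mathsf{Res}}(F)$ is the minimum over refutations of the length of the longest path in the proof DAG. Semantic Cutting Planes: a proof is a sequence of linear inequalities, each an input inequality (from the standard encoding: $0\le x\le1$ and $\sum_{P}x_i+\sum_N(1-x_i)\ge1$ for each clause) or deduced from at most two earlier ones $a_jx\ge c_j$, $a_kx\ge c_k$ provided every $\{0,1\}$ assignment satisfying both also satisfies the new inequality; a refutation derives an unsatisfiable inequality; $\mathrm{depth}_{\mathsf{sCP}}$ is the minimum over refutations of the longest path length in the proof DAG. *)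

(* Defs.v *)
From mathcomp Require Import all_boot all_order all_algebra.
From Stdlib Require Import ClassicalEpsilon.

Set Implicit Arguments.
Unset Strict Implicit.
Unset Printing Implicit Defensive.

Import Order.TTheory GRing.Theory Num.Theory.

(* CNF formulas over a finite type [V] of variables. The literal (v, true) is
   v and the literal (v, false) is its negation. *)

Definition literal (V : finType) : finType := (V * bool)%type.
Definition clause (V : finType) : finType := {set literal V}.
Definition cnf (V : finType) : finType := {set clause V}.
Definition assignment (V : finType) : finType := {ffun V -> bool}.

Definition neg_lit (V : finType) (l : literal V) : literal V := (l.1, ~~ l.2).

Definition clause_sat (V : finType) (alpha : assignment V) (C : clause V) :=
  [exists l in C, alpha l.1 == l.2].

Definition cnf_sat (V : finType) (alpha : assignment V) (F : cnf V) :=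
  [forall C in F, clause_sat alpha C].

Definition unsat (V : finType) (F : cnf V) :=
  forall alpha : assignment V, ~~ cnf_sat alpha F.

(* Composition with XOR_4: the variable (v, j) is x_{v,j}. The constraint
   x_{v,0} + x_{v,1} + x_{v,2} + x_{v,3} = b (mod 2) is the conjunction, over
   the s in {0,1}^4 of parity different from b, of the clause excluding s.
   A clause of F is the disjunction of such CNFs, one for each of its literals,
   and is turned into a CNF by distributivity: its clauses arise by picking,
   through c, one clause for each literal. *)

Definition parity4 (s : {ffun 'I_4 -> bool}) : bool :=
  \big[addb/false]_(j < 4) s j.

Definition exclude_block (V : finType) (v : V) (s : {ffun 'I_4 -> bool}) :
    clause (V * 'I_4)%type :=
  [set ((v, j), ~~ s j) | j : 'I_4].

Definition xor4_literal (V : finType) (l : literal V) : cnf (V * 'I_4)%type :=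
  [set exclude_block l.1 s | s : {ffun 'I_4 -> bool} & parity4 s != l.2].

Definition xor4_clause (V : finType) (C : clause V) : cnf (V * 'I_4)%type :=
  [set \bigcup_(l in C) c l
     | c : {ffun literal V -> clause (V * 'I_4)%type}
     & [forall l in C, c l \in xor4_literal l]].

Definition xor4 (V : finType) (F : cnf V) : cnf (V * 'I_4)%type :=
  \bigcup_(C in F) xor4_clause C.

(* Proof DAGs: a sequence of lines, each with the list of lines it is inferred
   from. [infer ps L] means that L follows from the lines ps in one step. *)

Record derivation (T : Type) := Derivation {
  dsize : nat;
  line : 'I_dsize -> T;
  prem : 'I_dsize -> seq 'I_dsize
}.

Definition valid (T : Type) (infer : seq T -> T -> Prop) (pi : derivation T) :=
  forall k : 'I_(dsize pi),
    all (fun j : 'I_(dsize pi) => j < k) (prem k) /\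
    infer [seq line j | j <- prem k] (line k).

Definition dag_edge (T : Type) (pi : derivation T) : rel 'I_(dsize pi) :=
  fun i j => j \in prem i.

(* The number of edges of a longest path; the bound m < dsize pi is no
   restriction, since a path in a DAG does not repeat vertices. *)
Definition dag_depth (T : Type) (pi : derivation T) : nat :=
  \max_(m < dsize pi |
        [exists k : 'I_(dsize pi), exists p : m.-tuple 'I_(dsize pi),
           path (@dag_edge T pi) k p]) m.

Definition is_min (P : nat -> Prop) (d : nat) :=
  P d /\ forall e : nat, P e -> d <= e.

Definition min_depth (T : Type) (refutes : derivation T -> Prop) : nat :=
  epsilon (inhabits 0)
    (is_min (fun d => exists2 pi, refutes pi & dag_depth pi = d)).

(* Resolution *)

Inductive res_infer (V : finType) (F : cnf V) :
    seq (clause V) -> clause V -> Prop :=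
| ResInput C of C \in F : res_infer F [::] C
| ResResolve (C D : clause V) (l : literal V) :
    res_infer F [:: l |: C; neg_lit l |: D] (C :|: D)
| ResWeaken (C D : clause V) of C \subset D : res_infer F [:: C] D.

Definition res_refutation (V : finType) (F : cnf V)
    (pi : derivation (clause V)) :=
  valid (res_infer F) pi /\
  exists k : 'I_(dsize pi), k.+1 = dsize pi /\ line k = set0.

Definition depth_Res (V : finType) (F : cnf V) : nat :=
  min_depth (res_refutation F).

(* Semantic Cutting Planes, with coefficients in an ordered domain R (the
   integers, the rationals, the reals). The pair (a, c) is the inequality
   \sum_v a_v x_v >= c. *)

Definition ineq (R : realDomainType) (V : finType) : Type :=
  ({ffun V -> R} * R)%type.

Definition ineq_holds (R : realDomainType) (V : finType) (alpha : assignment V)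
    (L : ineq R V) : bool :=
  (L.2 <= \sum_(v : V) L.1 v * (alpha v)%:R)%R.

Definition lower_ineq (R : realDomainType) (V : finType) (v : V) : ineq R V :=
  ([ffun u => (u == v)%:R], 0)%R.

Definition upper_ineq (R : realDomainType) (V : finType) (v : V) : ineq R V :=
  ([ffun u => - (u == v)%:R], - 1)%R.

(* \sum_(v in P) x_v + \sum_(v in N) (1 - x_v) >= 1, with the constant |N|
   moved to the right-hand side *)
Definition clause_ineq (R : realDomainType) (V : finType) (C : clause V) :
    ineq R V :=
  ([ffun v => ((v, true) \in C)%:R - ((v, false) \in C)%:R],
   1 - #|[set v : V | (v, false) \in C]|%:R)%R.

Inductive scp_input (R : realDomainType) (V : finType) (F : cnf V) :
    ineq R V -> Prop :=
| InputLower v : scp_input F (lower_ineq R v)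
| InputUpper v : scp_input F (upper_ineq R v)
| InputClause C of C \in F : scp_input F (clause_ineq R C).

Inductive scp_infer (R : realDomainType) (V : finType) (F : cnf V) :
    seq (ineq R V) -> ineq R V -> Prop :=
| ScpInput L of scp_input F L : scp_infer F [::] L
| ScpDeduce (ps : seq (ineq R V)) (L : ineq R V) of
    size ps <= 2 &
    (forall alpha : assignment V,
       all (ineq_holds alpha) ps -> ineq_holds alpha L) :
    scp_infer F ps L.

Definition ineq_unsat (R : realDomainType) (V : finType) (L : ineq R V) :=
  forall alpha : assignment V, ~~ ineq_holds alpha L.

Definition scp_refutation (R : realDomainType) (V : finType) (F : cnf V)
    (pi : derivation (ineq R V)) :=
  valid (scp_infer F) pi /\
  exists k : 'I_(dsize pi), ineq_unsat (line k).

Definition depth_sCP (R : realDomainType) (V : finType) (F : cnf V) : nat :=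
  min_depth (@scp_refutation R V F).

(* Sanity checks: the clause inequalities and the composition have the intended
   meaning, and unsatisfiable formulas have refutations, so that the minima
   above are attained. *)

Lemma clause_ineqE (R : realDomainType) (V : finType) (alpha : assignment V)
    (C : clause V) :
  ineq_holds alpha (clause_ineq R C) = clause_sat alpha C.
Proof.
rewrite /ineq_holds /= lerBlDr -sum1dep_card natr_sum.
rewrite [X in (_ + X)%R]big_mkcond -big_split /=.
rewrite (eq_bigr (fun v => ((((v, true) \in C) && alpha v) +
    (((v, false) \in C) && ~~ alpha v))%N%:R)%R); last first.
  move=> v _; rewrite ffunE natrD.
  case: (alpha v); case: (_ \in C); case: (_ \in C) => /=;
  by rewrite ?mulr1 ?mulr0 ?subr0 ?sub0r ?addr0 ?add0r ?subrr ?add0r ?addNr.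
rewrite -natr_sum ler1n lt0n sum_nat_eq0 negb_forall; apply/existsP/existsP.
- case=> v; rewrite implyTb addn_eq0 negb_and !eqb0 !negbK.
  case/orP=> /andP[lC av]; [exists (v, true)|exists (v, false)]; rewrite lC /=.
    by rewrite av.
  by rewrite eqbF_neg.
- case=> -[v b] /= /andP[lC /eqP av]; exists v.
  rewrite addn_eq0 negb_and !eqb0 !negbK av.
  by case: b lC {av} => ->; rewrite ?orbT.
Qed.

Lemma exclude_blockE (V : finType) (alpha : assignment (V * 'I_4)%type)
    (v : V) (s : {ffun 'I_4 -> bool}) :
  clause_sat alpha (exclude_block v s) = ([ffun j => alpha (v, j)] != s).
Proof.
apply/idP/idP.
- case/existsP=> l /andP[/imsetP[j _ ->]] /= av.
  by apply/eqP=> /ffunP/(_ j) sj; move: av; rewrite -sj ffunE; case: (alpha _).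
- apply: contraR => nsat; apply/eqP/ffunP=> j; rewrite ffunE.
  apply: contraNeq nsat => av; apply/existsP; exists ((v, j), ~~ s j).
  rewrite imset_f //=; by case: (alpha _) (s j) av => [] [].
Qed.

Lemma xor4_sat (V : finType) (F : cnf V) (alpha : assignment (V * 'I_4)%type) :
  cnf_sat alpha (xor4 F) =
  cnf_sat [ffun v => parity4 [ffun j => alpha (v, j)]] F.
Proof.
set beta := [ffun v => _].
apply/forall_inP/forall_inP => sat.
- move=> C CF; apply: contraT => nC.
  pose c := [ffun l : literal V => exclude_block l.1 [ffun j => alpha (l.1, j)]].
  have : clause_sat alpha (\bigcup_(l in C) c l).
    apply: sat; apply/bigcupP; exists C => //; apply: imset_f; rewrite inE.
    apply/forall_inP=> l lC; rewrite ffunE; apply: imset_f; rewrite inE.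
    apply: contraNneq nC => pl; apply/existsP; exists l.
    by rewrite lC ffunE pl /=.
  case/existsP=> l /andP[/bigcupP[l' l'C lc] al].
  have : clause_sat alpha (c l') by apply/existsP; exists l; rewrite lc.
  by rewrite ffunE exclude_blockE eqxx.
- move=> D /bigcupP[C CF /imsetP[c]]; rewrite inE => /forall_inP cP ->.
  case/existsP: (sat C CF) => l /andP[lC bl].
  case/imsetP: (cP l lC) => s; rewrite inE => sl cl.
  have : clause_sat alpha (c l).
    rewrite cl exclude_blockE; apply: contraNneq sl => <-.
    by move: bl; rewrite ffunE.
  case/existsP=> l' /andP[l'c al']; apply/existsP; exists l'.
  by rewrite al' andbT; apply/bigcupP; exists l.
Qed.

Lemma xor4_unsat (V : finType) (F : cnf V) : unsat F -> unsat (xor4 F).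
Proof. by move=> uF alpha; rewrite xor4_sat. Qed.

Section Derivable.
Variables (T : Type) (infer : seq T -> T -> Prop).

Definition add_line (pi : derivation T) (L : T) (ks : seq 'I_(dsize pi)) :=
  @Derivation T (dsize pi).+1
    (fun k => if unlift ord_max k is Some j then line j else L)
    (fun k => map (lift ord_max)
                (if unlift ord_max k is Some j then prem j else ks)).

Lemma add_line_valid pi L (ks : seq 'I_(dsize pi)) :
  valid infer pi -> infer [seq line j | j <- ks] L ->
  valid infer (add_line L ks).
Proof.
set pi' := add_line L ks.
have mapE ks' : map (@line _ pi') (map (@lift (dsize pi).+1 ord_max) ks') =
    map (@line _ pi) ks'.
  by rewrite -map_comp; apply: eq_map => j /=; rewrite liftK.
have ltE ks' (j : 'I_(dsize pi)) : all (fun i : 'I_(dsize pi) => i < j) ks' ->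
    all (fun i : 'I_(dsize pi).+1 => i < lift ord_max j)
      (map (lift ord_max) ks').
  by move=> /allP lt_j; apply/allP=> _ /mapP[i /lt_j lt_ij ->]; rewrite !lift_max.
move=> vpi iL k; rewrite [prem k]/= [line k]/= mapE.
case: (unliftP ord_max k) => [j|] ->; rewrite ?liftK ?unlift_none.
- by have [lt_j ij] := vpi j; split=> //; apply: ltE.
- split=> //; apply/allP=> i /mapP[j _ ->].
  by rewrite lift_max ltn_ord.
Qed.

Definition occurs (pi : derivation T) L := exists k : 'I_(dsize pi), line k = L.

Definition derivable L := forall pi, valid infer pi ->
  exists pi', [/\ valid infer pi', (forall M, occurs pi M -> occurs pi' M)
    & exists k : 'I_(dsize pi'), k.+1 = dsize pi' /\ line k = L].

Lemma derivable_step ps L :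
  (forall i, i < size ps -> derivable (nth L ps i)) -> infer ps L ->
  derivable L.
Proof.
move=> dps iL pi vpi.
have [pi' [vpi' sub [ks ksE]]] : exists pi', [/\ valid infer pi',
    (forall M, occurs pi M -> occurs pi' M) &
    exists ks : seq 'I_(dsize pi'), [seq line j | j <- ks] = ps].
  elim: ps dps {iL} => [|p ps IH] dps; first by exists pi; split=> //; exists [::].
  case: IH => [i ip|pi1 [v1 s1 [ks1 e1]]]; first exact: (dps i.+1).
  case: (dps 0 isT pi1 v1) => pi2 [v2 s2 [k [_ kE]]].
  exists pi2; split=> //; first by move=> M /s1/s2.
  have [ks2 e2] : exists ks : seq 'I_(dsize pi2),
      [seq line j | j <- ks] = [seq line j | j <- ks1].
    elim: ks1 {e1} => [|j ks1 [ks2 e2]]; first by exists [::].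
    have [|j' e'] := s2 (line j); first by exists j.
    by exists (j' :: ks2); rewrite /= e' e2.
  by exists (k :: ks2); rewrite /= kE e2 e1.
exists (add_line L ks); split.
- by apply: add_line_valid; rewrite ?ksE.
- move=> M /sub[k <-]; exists (lift ord_max k); by rewrite /= liftK.
- by exists ord_max; rewrite /= unlift_none.
Qed.

Lemma derivable_refutation L : derivable L ->
  exists2 pi, valid infer pi &
    exists k : 'I_(dsize pi), k.+1 = dsize pi /\ line k = L.
Proof.
pose absurd T' (k : 'I_0) : T' := match notF (ltn_ord k) with end.
case/(_ (@Derivation T 0 (absurd _) (absurd _))); first by case.
by move=> pi [v _ e]; exists pi.
Qed.

End Derivable.

Lemma min_depthP (T : Type) (refutes : derivation T -> Prop) :
  (exists pi, refutes pi) ->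
  is_min (fun d => exists2 pi, refutes pi & dag_depth pi = d)
    (min_depth refutes).
Proof.
case=> pi rpi; apply: epsilon_spec.
have: exists2 pi, refutes pi & dag_depth pi = dag_depth pi by exists pi.
move: {rpi}(ex_intro2 _ _ pi rpi erefl :
  exists2 pi', refutes pi' & dag_depth pi' = dag_depth pi).
move: (dag_depth pi) => d + _; elim/ltn_ind: d => d IH Pd.
case: (classic (exists2 e, e < d &
    exists2 pi', refutes pi' & dag_depth pi' = e)) => [[e]|noe]; first exact: IH.
exists d; split=> // e Pe; rewrite leqNgt; apply/negP=> lt_ed.
by apply: noe; exists e.
Qed.

Section Completeness.
Variables (V : finType) (F : cnf V).
Hypothesis uF : unsat F.

Let cl (S : {set V}) (alpha : assignment V) : clause V :=
  [set (v, ~~ alpha v) | v in S].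

Lemma clU (v : V) (S : {set V}) (alpha : assignment V) : cl (v |: S) alpha = (v, ~~ alpha v) |: cl S alpha.
Proof. by rewrite /cl imsetU1. Qed.

Let flip (v : V) (alpha : assignment V) : assignment V :=
  [ffun u => if u == v then ~~ alpha u else alpha u].

Lemma cl_flip (v : V) (S : {set V}) (alpha : assignment V) : v \notin S ->
  cl (v |: S) (flip v alpha) = neg_lit (v, ~~ alpha v) |: cl S alpha.
Proof.
move=> vS; rewrite clU ffunE eqxx /neg_lit /=; congr (_ |: _).
apply: eq_in_imset => u uS; rewrite ffunE.
by case: eqP => // uv; rewrite -uv uS in vS.
Qed.

Lemma cl_full (alpha : assignment V) : exists2 C, C \in F & C \subset cl setT alpha.
Proof.
move: (uF alpha); rewrite negb_forall => /existsP[C].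
rewrite negb_imply => /andP[CF nC]; exists C => //; apply/subsetP=> -[v b] lC.
apply/imsetP; exists v => //; congr (_, _).
move: nC; rewrite negb_exists => /forallP/(_ (v, b)); rewrite lC /=.
by case: (alpha v) b {lC} => [] [].
Qed.

Lemma cl_ind (P : clause V -> Prop) :
  (forall C D : clause V, C \in F -> C \subset D -> P D) ->
  (forall (C : clause V) l, P (l |: C) -> P (neg_lit l |: C) -> P C) -> P set0.
Proof.
move=> Pin Pres.
have PS k : forall (S : {set V}) (alpha : assignment V), #|~: S| = k -> P (cl S alpha).
  elim: k => [|k IH] S alpha.
    move/eqP; rewrite cards_eq0 -setCT (inj_eq (@setC_inj V)) => /eqP ->.
    by have [C CF CS] := cl_full alpha; apply: Pin CF CS.
  move=> Sk; have [v] : exists v, v \in ~: S by apply/card_gt0P; rewrite Sk.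
  move=> vS; have card_vS : #|~: (v |: S)| = k.
    by apply/eqP; rewrite -eqSS -Sk (cardsD1 v (~: S)) vS setCU setDE setIC.
  rewrite inE in vS; apply: (Pres _ (v, ~~ alpha v)).
    by rewrite -clU; apply: IH.
  by rewrite -cl_flip //; apply: IH.
by have := PS _ set0 [ffun=> true] erefl; rewrite /cl imset0.
Qed.

Lemma depth_ResP :
  is_min (fun d => exists2 pi, res_refutation F pi & dag_depth pi = d)
    (depth_Res F).
Proof.
apply: min_depthP.
have [|pi v e] := @derivable_refutation _ (res_infer F) set0; last by exists pi.
apply: cl_ind => [C D CF CD|C l dl dnl].
  apply: derivable_step (ResWeaken F CD) => -[|//] _ /=.
  exact: derivable_step (ResInput CF).
rewrite -(setUid C); apply: derivable_step (ResResolve F C C l).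
by case=> [|[|//]].
Qed.

Lemma depth_sCPP (R : realDomainType) :
  is_min (fun d => exists2 pi, @scp_refutation R V F pi & dag_depth pi = d)
    (depth_sCP R F).
Proof.
apply: min_depthP.
have [|pi v [k [_ kE]]] :=
  @derivable_refutation _ (@scp_infer R V F) (clause_ineq R set0).
  pose P C := derivable (@scp_infer R V F) (clause_ineq R C).
  apply: (@cl_ind P) => [C D CF CD|C l dl dnl].
    apply: (@derivable_step _ _ [:: clause_ineq R C]).
      case=> [|//] _ /=; apply: (@derivable_step _ _ [::]) => //.
      by apply: ScpInput; apply: InputClause.
    apply: ScpDeduce => // alpha; rewrite /= andbT !clause_ineqE.
    case/existsP=> l /andP[lC al]; apply/existsP; exists l.
    by rewrite al (subsetP CD).
  apply: (@derivable_step _ _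
    [:: clause_ineq R (l |: C); clause_ineq R (neg_lit l |: C)]).
    by case=> [|[|//]].
  apply: ScpDeduce => // alpha; rewrite /= andbT !clause_ineqE.
  case/andP=> /existsP[l1 /andP[]]; rewrite !inE => /orP[/eqP-> al|lC al] ;
    last by move=> _; apply/existsP; exists l1; rewrite lC.
  case/existsP=> l2 /andP[]; rewrite !inE => /orP[/eqP-> /=|lC al2].
    by rewrite (eqP al); case: (l.2).
  by apply/existsP; exists l2; rewrite lC.
exists pi; split=> //; exists k => alpha; rewrite kE clause_ineqE.
by apply/existsP=> -[l]; rewrite inE.
Qed.

End Completeness.

(* Main.v *)
Require Import Defs.
From mathcomp Require Import all_boot all_order all_algebra.
From mathcomp Require Import ring lra zify.
From Stdlib Require Import Classical.

(* A path is followed down a semantic Cutting Planes refutation of the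
   composed formula, keeping some blocks of four variables fixed so that the
   current inequality L fails at the center of the remaining subcube. Negating a
   whole block preserves its parity, so one of any two antipodal points of the
   subcube falsifies L: the falsifying points realize all parities of the free
   blocks, and a falsified input clause yields a clause of F falsified by the
   parities of the fixed blocks. Let L follow from L1 and L2. If, for every
   choice of at most two blocks, some values of their parities are such that,
   however these are realized, L1 and L2 hold at the new center, then any two
   coefficients of L1, and any two of L2, are small; by vector balancing in
   dimension two, there is then a pair of antipodal points satisfying both L1
   and L2, hence L, a contradiction. So each step costs at most two queries to
   variables of F. *)

Set Implicit Arguments.
Unset Strict Implicit.
Unset Printing Implicit Defensive.

Import Order.TTheory GRing.Theory Num.Theory.

(** * Lengths of paths in proof DAGs *)

Lemma path_potential (T : Type) (e : rel T) (f : T -> nat) :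
  (forall x y, e x y -> f y < f x) ->
  forall p x, path e x p -> size p + f (last x p) <= f x.
Proof.
move=> ef; elim=> [|y p IH] x //= /andP[/ef xy /IH]; lia.
Qed.

(** Premises have smaller indices, so a path has fewer edges than the proof has lines and is among
    those over which the maximum is taken. *)
Lemma path_dag_depth (T : Type) (infer : seq T -> T -> Prop)
    (pi : derivation T) (k : 'I_(dsize pi)) (p : seq 'I_(dsize pi)) :
  valid infer pi -> path (@dag_edge T pi) k p -> size p <= dag_depth pi.
Proof.
move=> vpi kp.
have lt_p : size p < dsize pi.
  apply: leq_trans (ltn_ord k); rewrite ltnS.
  have := @path_potential _ (@dag_edge T pi) (@nat_of_ord _) _ _ _ kp.
  move=> /(_ _)/(leq_trans (leq_addr _ _)); apply=> i j.
  by have [/allP/(_ j)] := vpi i.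
rewrite /dag_depth (bigD1 (Ordinal lt_p)) ?leq_maxl //=.
apply/existsP; exists k; apply/existsP; exists (in_tuple p); exact: kp.
Qed.

(** * Resolution derivations obtained from queries to variables *)

Section Resolution.
Variables (V : finType) (F : cnf V) (H : nat).

(* Clauses carry a rank that bounds the length of every path below them. *)
Definition ranked_res_infer (ps : seq (clause V * nat)) (L : clause V * nat) :=
  [/\ res_infer F [seq p.1 | p <- ps] L.1, all (fun p => p.2 < L.2) ps
    & L.2 <= H].

(* Passing to a subclause saves the edge that a weakening step would cost. *)
Definition derivable_within (h : nat) (C : clause V) :=
  exists2 C' : clause V, C' \subset C &
  exists2 h', h' <= h & derivable ranked_res_infer (C', h').

(** Ranks drop strictly along edges and never exceed [H], so erasing them leaves a refutation of
    depth at most [H]. *)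
Lemma derivable_within_refutation h :
  unsat F -> derivable_within h set0 -> depth_Res F <= H.
Proof.
move=> uF [C]; rewrite subset0 => /eqP-> [h' _ d0].
have [pi vpi [k [kn kE]]] := derivable_refutation d0.
pose pi' := @Derivation (clause V) (dsize pi) (fun i => (line i).1) (@prem _ pi).
have rankP (i : 'I_(dsize pi)) : (line i).2 <= H by case: (vpi i) => _ [].
have le_H : dag_depth pi' <= H.
  apply/bigmax_leqP=> m /existsP[i /existsP[p]].
  move/(@path_potential _ _ (fun i : 'I_(dsize pi') => (@line _ pi i).2)) => /(_ _).
  rewrite size_tuple => le_m; apply: leq_trans (rankP i).
  apply: leq_trans (leq_addr _ _) (le_m _) => a b ab.
  by have [_ [_ /allP/(_ (@line _ pi b)) -> //]] := vpi a; apply: map_f.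
apply: leq_trans le_H; have [_ -> //] := depth_ResP uF; exists pi' => //; split.
  move=> i; have [lt_i [inf _ _]] := vpi i; split=> //.
  by rewrite -map_comp in inf.
by exists k; split=> //; rewrite /= kE.
Qed.

Lemma derivable_within_leq h1 h2 C :
  h1 <= h2 -> derivable_within h1 C -> derivable_within h2 C.
Proof.
move=> le12 [C' CC' [h le_h dC']]; exists C' => //; exists h => //.
exact: leq_trans le12.
Qed.

Lemma derivable_within_input h (C D : clause V) :
  C \in F -> C \subset D -> derivable_within h D.
Proof.
move=> CF CD; exists C => //; exists 0 => //.
by apply: (@derivable_step _ _ [::]) => //; split=> //; apply: ResInput.
Qed.

(** A premise that lacks its pivot literal is already a subclause of [C]; otherwise the two premises
    are resolved. *)
Lemma derivable_within_query h (C : clause V) (l : literal V) : h < H ->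
  derivable_within h (l |: C) -> derivable_within h (neg_lit l |: C) ->
  derivable_within h.+1 C.
Proof.
move=> lt_h [C1 C1C [h1 le1 d1]] [C2 C2C [h2 le2 d2]].
have [lC1|lC1] := boolP (l \in C1); last first.
  exists C1; last by exists h1 => //; apply: leqW.
  apply/subsetP=> l' l'C1; have := subsetP C1C _ l'C1.
  by case/setU1P=> // l'l; rewrite -l'l l'C1 in lC1.
have [lC2|lC2] := boolP (neg_lit l \in C2); last first.
  exists C2; last by exists h2 => //; apply: leqW.
  apply/subsetP=> l' l'C2; have := subsetP C2C _ l'C2.
  by case/setU1P=> // l'l; rewrite -l'l l'C2 in lC2.
exists ((C1 :\ l) :|: (C2 :\ neg_lit l)).
  by rewrite subUset !subDset C1C C2C.
exists h.+1 => //; apply: (@derivable_step _ _ [:: (C1, h1); (C2, h2)]).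
  by case=> [|[|//]].
split=> //=; last by rewrite !ltnS le1 le2.
have := ResResolve F (C1 :\ l) (C2 :\ neg_lit l) l.
by rewrite !setD1K.
Qed.

Definition falsified_clause (S : {set V}) (z : V -> bool) : clause V :=
  [set (v, ~~ z v) | v in S].

(** The variables of [T] are queried one at a time, each at the cost of one level; [z'] runs over
    all possible answers. *)
Lemma derivable_within_queries h (S T : {set V}) (z : V -> bool) :
  h + #|T| <= H ->
  (forall z' : V -> bool, {in S, z' =1 z} ->
     derivable_within h (falsified_clause (S :|: T) z')) ->
  derivable_within (h + #|T|) (falsified_clause S z).
Proof.
move En : #|T| => n; elim: n S T z En => [|n IH] S T z En le_H dT.
  move/eqP: En; rewrite cards_eq0 => /eqP T0; rewrite addn0.
  by have := dT z; rewrite T0 setU0; apply.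
have /card_gt0P[v vT] : 0 < #|T| by rewrite En.
have Tn : #|T :\ v| = n by move: En; rewrite (cardsD1 v T) vT => -[].
rewrite addnS in le_H *.
have [vS|vS] := boolP (v \in S).
  apply: derivable_within_leq (leqnSn _) (IH S _ z Tn (ltnW le_H) _) => z' /dT.
  congr (derivable_within h (falsified_clause _ z')); apply/setP=> u.
  by rewrite !inE; case: eqP => // ->; rewrite vS.
have dv b : derivable_within (h + n) ((v, b) |: falsified_clause S z).
  pose zb u := if u == v then ~~ b else z u.
  suff -> : (v, b) |: falsified_clause S z = falsified_clause (v |: S) zb.
    apply: (IH _ (T :\ v)) => //; first exact: ltnW.
    move=> z' z'z; rewrite -setUA setUCA setD1K //; apply: dT => u uS.
    rewrite z'z ?inE ?uS ?orbT // /zb.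
    by case: eqP => // uv; rewrite -uv uS in vS.
  rewrite /falsified_clause imsetU1 /zb eqxx negbK; congr (_ |: _).
  apply: eq_in_imset => u uS.
  by case: eqP => // uv; rewrite -uv uS in vS.
by apply: (@derivable_within_query _ _ (v, true)) => //; apply: dv.
Qed.

End Resolution.

Local Open Scope ring_scope.

(** * Vector balancing in dimension two *)

Definition sg {R : realDomainType} (b : bool) : R := if b then 1 else -1.

Lemma sgN (R : realDomainType) b : sg (~~ b) = - sg b :> R.
Proof. by case: b; rewrite /= ?opprK. Qed.

Section Balancing.
Variables (R : realDomainType) (I : finType).

(** The cross product of the two rows works unless its last entry vanishes; then the first two
    columns are dependent. *)
Lemma kernel3 (a1 a2 b1 b2 c1 c2 : R) : exists k : R * R * R,
  [/\ k <> (0, 0, 0),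
      a1 * k.1.1 + b1 * k.1.2 + c1 * k.2 = 0 &
      a2 * k.1.1 + b2 * k.1.2 + c2 * k.2 = 0].
Proof.
have [d0|d0] := eqVneq (a1 * b2 - a2 * b1) 0; last first.
  exists (b1 * c2 - b2 * c1, c1 * a2 - c2 * a1, a1 * b2 - a2 * b1).
  by split=> /=; [case=> _ _ /eqP; apply/negP|ring|ring].
have [a10|a10] := eqVneq a1 0; last first.
  exists (b1, - a1, 0); split=> /=.
  - by case=> _ /eqP; rewrite oppr_eq0 (negPf a10).
  - by ring.
  - by transitivity (- (a1 * b2 - a2 * b1)); [ring|rewrite d0 oppr0].
have [a20|a20] := eqVneq a2 0.
  exists (1, 0, 0); split=> /=; rewrite ?a10 ?a20; try by ring.
  by case=> /eqP; rewrite oner_eq0.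
exists (b2, - a2, 0); split=> /=.
- by case=> _ /eqP; rewrite oppr_eq0 (negPf a20).
- by transitivity (a1 * b2 - a2 * b1); [ring|].
- by ring.
Qed.

Variables w1 w2 : I -> R.

(* The point [u / D] of the cube [-1, 1]^I; the denominator is kept apart
   because [R] need not be a field. *)
Definition cube_point (D : R) (u : I -> R) :=
  [/\ 0 < D, forall i, `|u i| <= D,
      \sum_i w1 i * u i = 0 & \sum_i w2 i * u i = 0].

Definition interior_coords (D : R) (u : I -> R) := [set i | `|u i| < D].

(** The point moves in the direction [k] until a first coordinate reaches the boundary. *)
Lemma move_to_boundary D u k i0 : cube_point D u ->
  (forall i, k i != 0 -> i \in interior_coords D u) -> k i0 != 0 ->
  \sum_i w1 i * k i = 0 -> \sum_i w2 i * k i = 0 ->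
  exists D' u', cube_point D' u' /\
    (#|interior_coords D' u'| < #|interior_coords D u|)%N.
Proof.
move=> [D0 uD u1 u2] kA k0 k1 k2.
(* Coordinate [i] reaches the boundary at time [num i / den i]; [ord] compares these times without
   division. *)
pose num i := D - Num.sg (k i) * u i; pose den i := `|k i|.
pose ord i j := num i * den j <= num j * den i.
have ndE i : k i != 0 -> 0 < den i by rewrite normr_gt0.
have numP i : k i != 0 -> 0 < num i.
  move=> ki; have := kA _ ki; rewrite inE subr_gt0; apply: le_lt_trans.
  by rewrite (le_trans (ler_norm _)) // normrM normr_sg ki mul1r.
have [m km mP] : exists2 m, k m != 0 & forall i, k i != 0 -> ord m i.
  have [|j i l|i j|m ? ?] :=
    @extremum_inP _ _ ord i0 (fun i => k i != 0) id _ _ _ k0; last by exists m.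
  - by move=> i _; apply: lexx.
  - rewrite ![_ \in _]/in_mem /= => kj ki kl; rewrite /relpre /= /ord => ij jl.
    rewrite -(ler_pM2l (ndE _ kj)).
    rewrite (le_trans (y := num j * den i * den l)) //.
      by rewrite mulrCA mulrA ler_pM2r ?ndE // mulrC.
    by rewrite mulrAC [leRHS]mulrA [_ * num l]mulrC ler_pM2r ?ndE.
  - by move=> _ _; apply: le_total.
exists (D * den m), (fun i => u i * den m + num m * k i).
have dm := ndE m km; have nm := numP m km.
have bnd i : `|u i * den m + num m * k i| <= D * den m.
  have [ki|ki] := eqVneq (k i) 0.
    by rewrite ki mulr0 addr0 normrM [`|den m|]ger0_norm ?ler_wpM2r // ltW.
  have := mP i ki; have := uD i; have := ndE i ki; have := numP i ki.
  rewrite /ord /num /den ler_norml; case: (ltrgtP (k i) 0) ki => [ki|ki|//] _.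
    rewrite ltr0_sg // ltr0_norm // => n1 d1 /andP[l1 l2] o.
    rewrite ler_norml; apply/andP; split; rewrite /den /num in dm nm o *; nra.
  rewrite gtr0_sg // gtr0_norm // => n1 d1 /andP[l1 l2] o.
  rewrite ler_norml; apply/andP; split; rewrite /den /num in dm nm o *; nra.
split.
  have sumE w : \sum_i w i * u i = 0 -> \sum_i w i * k i = 0 ->
      \sum_i w i * (u i * den m + num m * k i) = 0.
    move=> wu wk.
    rewrite (eq_bigr (fun i => w i * u i * den m + w i * k i * num m)).
      by rewrite big_split /= -!mulr_suml wu wk !mul0r addr0.
    by move=> i _; ring.
  by split=> //; [apply: mulr_gt0|apply: sumE|apply: sumE].
apply: proper_card; apply/properP; split.
  apply/subsetP=> i; apply: contraTT => iA.
  have ki : k i = 0 by apply/eqP; apply: contraNT iA; apply: kA.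
  rewrite inE ki mulr0 addr0 normrM [`|den m|]ger0_norm ?ltW // ltr_pM2r //.
  by move: iA; rewrite inE.
exists m; first exact: kA.
rewrite inE -leNgt.
suff -> : u m * den m + num m * k m = D * k m by rewrite normrM gtr0_norm.
by rewrite /num /den normrEsg; ring.
Qed.

(** Three interior coordinates support a nonzero direction that keeps both linear constraints, so
    their number can be lowered. *)
Lemma few_interior_coords : exists D u, cube_point D u /\
  (#|interior_coords D u| <= 2)%N.
Proof.
have [n] := ubnP #|interior_coords 1 (fun=> 0 : R)|.
have : cube_point 1 (fun=> 0).
  by split=> [//|i||]; rewrite ?normr0 //; apply: big1 => i _; rewrite mulr0.
move: (1 : R) (fun=> 0 : R).
elim: n => // n IH D u cu.
have [|/card_gt2P[a [b [c [[aA bA cA] [ab bc ca]]]]]] :=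
  leqP #|interior_coords D u| 2; first by exists D, u.
rewrite ltnS => le_n.
have [[[x y] z] /= [k0 e1 e2]] :=
  kernel3 (w1 a) (w2 a) (w1 b) (w2 b) (w1 c) (w2 c).
pose k i := if i == a then x else if i == b then y else if i == c then z else 0.
have ka : k a = x by rewrite /k eqxx.
have kb : k b = y by rewrite /k eq_sym (negPf ab) eqxx.
have kc : k c = z by rewrite /k (negPf ca) eq_sym (negPf bc) eqxx.
have kE w : \sum_i w i * k i = w a * x + w b * y + w c * z.
  rewrite (bigD1 a) //= (bigD1 b) /= 1?eq_sym // (bigD1 c) /=; last first.
    by rewrite ca eq_sym.
  rewrite ka kb kc big1 ?addr0 ?addrA // => i /andP[/andP[ia ib] ic].
  by rewrite /k (negPf ia) (negPf ib) (negPf ic) mulr0.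
have [i0 ki0] : exists i0, k i0 != 0.
  apply: NNPP => nk; apply: k0.
  have k0 i : k i = 0 by apply/eqP; apply: contra_notT nk => ki; exists i.
  by rewrite -ka -kb -kc !k0.
have [i|||D' [u' [cu' lt']]] := move_to_boundary cu _ ki0.
- rewrite /k; case: (i =P a) => [->//|_]; case: (i =P b) => [->//|_].
  by case: (i =P c) => [->//|_]; rewrite eqxx.
- by rewrite kE.
- by rewrite kE.
by apply: (IH D' u' cu'); apply: leq_trans le_n.
Qed.

(* Barany-Grinberg in dimension two: a point of the cube orthogonal to both
   weight vectors, with at most two coordinates off the boundary, is rounded. *)
Lemma balancing (c1 c2 : R) :
  (forall J : {set I}, (#|J| <= 2)%N ->
     \sum_(i in J) `|w1 i| <= c1 /\ \sum_(i in J) `|w2 i| <= c2) ->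
  exists e : I -> bool,
    `|\sum_i w1 i * sg (e i)| <= c1 /\ `|\sum_i w2 i * sg (e i)| <= c2.
Proof.
have [D [u [[D0 uD u1 u2] /[swap] /[apply]]]] := few_interior_coords.
set J := interior_coords D u => -[J1 J2]; exists (fun i => 0 <= u i).
suff bnd w (c : R) : \sum_i w i * u i = 0 -> \sum_(i in J) `|w i| <= c ->
  `|\sum_i w i * sg (0 <= u i)| <= c by split; apply: bnd.
(* Scaled by [D], the rounded sum differs from the zero sum only on [J], where each coordinate moves
   by at most [D]. *)
move=> wu; apply: le_trans; rewrite -(ler_pM2l D0) -[X in X * `|_|]gtr0_norm //.
rewrite -normrM -[X in `|X|]subr0 -[X in _ - X]wu mulr_sumr -sumrB.
rewrite (bigID (mem J)) /= [X in _ + X]big1 ?addr0 => [|i].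
  rewrite (le_trans (ler_norm_sum _ _ _)) // mulr_sumr ler_sum // => i _.
  rewrite mulrCA -mulrBr normrM mulrC ler_wpM2r //.
  have := uD i; rewrite !ler_norml /sg.
  by case: (leP 0 (u i)) => ui /andP[l r]; apply/andP; split; lra.
rewrite inE -leNgt => Du; have {}uD : `|u i| = D by apply/eqP; rewrite eq_le uD.
rewrite mulrCA -mulrBr -uD /sg; case: (leP 0 (u i)) => ui.
  by rewrite ger0_norm // mulr1 subrr mulr0.
by rewrite ltr0_norm // mulrN1 opprK subrr mulr0.
Qed.
End Balancing.

(** * Inequalities failing at the center, and one inference step *)

Lemma parity4_flip (K : {set 'I_4}) (s : {ffun 'I_4 -> bool}) :
  parity4 [ffun j => s j (+) (j \in K)] = parity4 s (+) odd #|K|.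
Proof.
rewrite /parity4 (eq_bigr (fun j => s j (+) (j \in K))) => [|j _]; last first.
  by rewrite ffunE.
rewrite big_split /=; congr (_ (+) _).
rewrite -sum1_card (big_morph odd oddD (erefl : odd 0 = false)) [RHS]big_mkcond /=.
by apply: eq_bigr => j _; case: (j \in K).
Qed.

Section Step.
Variables (R : realDomainType) (V : finType).

(* Flipping two coordinates outside [A] preserves the parity and changes the
   sign of their contribution. *)
Lemma parity_block_minimum (a : 'I_4 -> R) (A : {set 'I_4}) (b : bool) :
  (#|A| <= 2)%N ->
  exists s, parity4 s = b /\ \sum_j a j * sg (s j) <= - \sum_(j in A) `|a j|.
Proof.
move=> A2; have : (1 < #|~: A|)%N.
  by have := cardsC A; rewrite card_ord; lia.
case/card_gt1P=> r [r' []]; rewrite !inE => rA r'A rr'.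
pose K := [set r; r'].
(* [s0] minimizes every term; if its parity is wrong, a flip at [r] repairs it. *)
pose s0 : {ffun 'I_4 -> bool} := [ffun j => a j < 0].
have s0E j : a j * sg (s0 j) = - `|a j|.
  rewrite ffunE /sg; case: ltP => aj.
    by rewrite ltr0_norm // mulr1 opprK.
  by rewrite ger0_norm // mulrN1.
have [s1 [p1 s1E]] : exists s1, parity4 s1 = b /\
    forall j, j \notin K -> s1 j = s0 j.
  have [p0|p0] := eqVneq (parity4 s0) b; first by exists s0.
  exists [ffun j => s0 j (+) (j \in [set r])]; split.
    by rewrite parity4_flip cards1; case: b (parity4 s0) p0 => [] [].
  by move=> j; rewrite ffunE !inE; case: (j == r) => //; rewrite addbF.
pose s2 : {ffun 'I_4 -> bool} := [ffun j => s1 j (+) (j \in K)].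
have p2 : parity4 s2 = b by rewrite parity4_flip cards2 rr' addbF.
pose X := \sum_(j in K) a j * sg (s1 j).
have offK s : (forall j, j \notin K -> s j = s0 j) ->
    \sum_(j | j \notin K) a j * sg (s j) <= - \sum_(j in A) `|a j|.
  move=> sE; rewrite (eq_bigr (fun j => - `|a j|)) => [|j jK]; last first.
    by rewrite sE.
  rewrite sumrN lerN2 [leLHS]big_mkcond [leRHS]big_mkcond ler_sum // => j _.
  case: ifP => jA; last by case: ifP.
  rewrite ifT // !inE negb_or; apply/andP.
  by split; apply: contraTneq jA => ->.
have [X0|X0] := leP X 0.
  exists s1; split=> //; rewrite (bigID (mem K)) /=.
  by rewrite -[leRHS]add0r lerD ?offK.
exists s2; split=> //; rewrite (bigID (mem K)) /= -[leRHS]add0r lerD ?offK //.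
  rewrite (eq_bigr (fun j => - (a j * sg (s1 j)))) => [|j jK].
    by rewrite sumrN oppr_le0 ltW.
  by rewrite ffunE jK addbT sgN mulrN.
by move=> j jK; rewrite ffunE (negPf jK) addbF s1E.
Qed.

Local Notation W := (V * 'I_4)%type.

(* The right-hand side of [L] after the change of variables [x = (1 + u) / 2],
   scaled by 2: the cube becomes [-1, 1]^W, with center 0. *)
Definition centered_bound (L : ineq R W) : R := L.2 *+ 2 - \sum_i L.1 i.

Lemma ineq_holds_centered (alpha : assignment W) (L : ineq R W) :
  ineq_holds alpha L = (centered_bound L <= \sum_i L.1 i * sg (alpha i)).
Proof.
rewrite /ineq_holds /centered_bound lerBlDr -big_split /=.
rewrite [in RHS](eq_bigr (fun i => (L.1 i * (alpha i)%:R) *+ 2)) => [|i _].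
  by rewrite sumrMnl lerMn2r.
by rewrite /sg; case: (alpha i) => /=; ring.
Qed.

(* [L] fails at the center of the subcube where the blocks in [S] are given by
   [y] and all other coordinates are free. *)
Definition center_falsifies (S : {set V}) (y : assignment W) (L : ineq R W) :=
  \sum_(i | i.1 \in S) L.1 i * sg (y i) < centered_bound L.

(** The free parts at [e] and at its complement are opposite, so one of them is at most zero. *)
Lemma center_falsifies_antipodal (S : {set V}) (y : assignment W) (L : ineq R W)
    (e : W -> bool) :
  center_falsifies S y L ->
  exists b, ~~ ineq_holds [ffun i => if i.1 \in S then y i else e i (+) b] L.
Proof.
rewrite /center_falsifies => cL.
pose X := \sum_(i | i.1 \notin S) L.1 i * sg (e i).
have fixE b : \sum_(i | i.1 \in S) L.1 i *
    sg ([ffun i : W => if i.1 \in S then y i else e i (+) b] i) =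
    \sum_(i | i.1 \in S) L.1 i * sg (y i).
  by apply: eq_bigr => i iS; rewrite ffunE iS.
have [X0|X0] := leP X 0.
  exists false; rewrite ineq_holds_centered -ltNge.
  rewrite (bigID (fun i => i.1 \in S)) /= fixE.
  rewrite [X in _ + X](eq_bigr (fun i => L.1 i * sg (e i))) -/X; first lra.
  by move=> i iS; rewrite ffunE (negPf iS) addbF.
exists true; rewrite ineq_holds_centered -ltNge.
rewrite (bigID (fun i => i.1 \in S)) /= fixE.
rewrite [X in _ + X](eq_bigr (fun i => - (L.1 i * sg (e i)))) ?sumrN -/X; first lra.
by move=> i iS; rewrite ffunE (negPf iS) addbT sgN mulrN.
Qed.

Definition block_parity (y : assignment W) (v : V) := parity4 [ffun j => y (v, j)].

Lemma center_falsifies_parity (S : {set V}) (y : assignment W) (L : ineq R W)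
    (z : V -> bool) :
  center_falsifies S y L -> {in S, block_parity y =1 z} ->
  exists2 alpha, ~~ ineq_holds alpha L & block_parity alpha =1 z.
Proof.
(* The first coordinate of each block carries the wanted parity; complementing all four keeps it. *)
pose e (i : W) := z i.1 && (i.2 == ord0).
move=> /(@center_falsifies_antipodal _ _ _ e)[b nL] yz.
exists [ffun i => if i.1 \in S then y i else e i (+) b] => // v.
have [vS|vS] := boolP (v \in S).
  rewrite -yz // /block_parity; congr parity4.
  by apply/ffunP=> j; rewrite !ffunE vS.
rewrite /block_parity /parity4.
rewrite (eq_bigr (fun j => e (v, j) (+) b)) => [|j _]; last first.
  by rewrite !ffunE (negPf vS).
rewrite !big_ord_recl big_ord0 /e /=.
by case: (z v) b {nL} => [] [].
Qed.

Lemma center_falsifies_step (S : {set V}) (y : assignment W)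
    (L L1 L2 : ineq R W) :
  center_falsifies S y L ->
  (forall alpha, ineq_holds alpha L1 -> ineq_holds alpha L2 ->
     ineq_holds alpha L) ->
  exists2 T : {set V}, (#|T| <= 2)%N & forall z : V -> bool,
    {in S, block_parity y =1 z} -> exists y',
      [/\ {in S :|: T, block_parity y' =1 z} &
          center_falsifies (S :|: T) y' L1 \/ center_falsifies (S :|: T) y' L2].
Proof.
move=> cL imp; apply: NNPP => noT.
pose w (M : ineq R W) i := if i.1 \in S then 0 else M.1 i.
(* If the free part of [M] is at most [gap M] in absolute value, then [M] holds at the point and at
   its antipode. *)
pose gap (M : ineq R W) := \sum_(i | i.1 \in S) M.1 i * sg (y i) - centered_bound M.
have sumJ (J : {set W}) : (#|J| <= 2)%N ->
    \sum_(i in J) `|w L1 i| <= gap L1 /\ \sum_(i in J) `|w L2 i| <= gap L2.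
  move=> J2; apply: NNPP => nJ; apply: noT.
  pose T := [set i.1 | i in J & i.1 \notin S].
  exists T => [|z yz].
    rewrite (leq_trans (leq_imset_card _ _)) // (leq_trans _ J2) //.
    by apply/subset_leq_card/subsetP=> i; rewrite inE => /andP[].
  (* With the parities on [T] prescribed by [z], the new blocks can still lower the left side of [M]
     by its weight on [J]; if this exceeds [gap M], then [M] fails at the new center. *)
  have best (M : ineq R W) : exists2 y', {in S :|: T, block_parity y' =1 z} &
      \sum_(i | i.1 \in S :|: T) M.1 i * sg (y' i) <=
      \sum_(i | i.1 \in S) M.1 i * sg (y i) - \sum_(i in J) `|w M i|.
    have /fin_all_exists[s sP] v : exists s : {ffun 'I_4 -> bool}, parity4 s = z v /\
        \sum_j M.1 (v, j) * sg (s j) <= - \sum_(j | (v, j) \in J) `|M.1 (v, j)|.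
      have [|s [sz s_le]] := @parity_block_minimum (fun j => M.1 (v, j))
          [set j | (v, j) \in J] (z v).
        rewrite -(card_imset _ (can_inj (fun j => erefl : (v, j).2 = j))).
        apply: leq_trans J2; apply/subset_leq_card/subsetP=> _ /imsetP[j + ->].
        by rewrite inE.
      exists s; split=> //; move: s_le.
      by rewrite [X in - X](eq_bigl (fun j => (v, j) \in J)) // => j; rewrite inE.
    exists [ffun i => if i.1 \in S then y i else s i.1 i.2] => [v _|].
      rewrite /block_parity; have [vS|vS] := boolP (v \in S).
        by rewrite -yz //; congr parity4; apply/ffunP=> j; rewrite !ffunE vS.
      have [<- _] := sP v; congr parity4.
      by apply/ffunP=> j; rewrite !ffunE (negPf vS).
    rewrite (bigID (fun i => i.1 \in S)) /= lerD //.
      rewrite (eq_big (fun i => i.1 \in S) (fun i => M.1 i * sg (y i))) // => i.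
        by rewrite inE; case: (i.1 \in S); rewrite ?andbF.
      by case/andP=> _ iS; rewrite ffunE iS.
    have TS v : v \in T -> v \notin S.
      by case/imsetP=> i; rewrite inE => /andP[_ iS] ->.
    rewrite (eq_big (fun i => (i.1 \in T) && true)
        (fun i => M.1 (i.1, i.2) * sg (s i.1 i.2))); last first.
    - by move=> [v j] /andP[_ vS]; rewrite ffunE (negPf vS).
    - move=> i; rewrite inE andbT; have := TS i.1.
      by case: (i.1 \in S); case: (i.1 \in T) => //= ->.
    rewrite -(pair_big (mem T) predT (fun v j => M.1 (v, j) * sg (s v j))) /=.
    rewrite (le_trans (ler_sum _ (fun v _ => (sP v).2))) // sumrN lerN2.
    rewrite pair_big_dep /= [leLHS](bigID (fun i => i.1 \in S)) /=.
    rewrite big1 ?add0r => [|i /andP[_ iS]]; last by rewrite /w iS normr0.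
    rewrite (eq_big (fun i => (i.1 \in T) && ((i.1, i.2) \in J))
        (fun i => `|M.1 (i.1, i.2)|)) //.
      move=> [v j] /=; apply/andP/andP => -[] h1 h2; split=> //; last exact: TS.
      by apply/imsetP; exists (v, j); rewrite ?inE ?h1.
    by case=> v j /andP[_ vS]; rewrite /w (negPf vS).
  have [le1|lt1] := leP (\sum_(i in J) `|w L1 i|) (gap L1); last first.
    have [y' y'z y'le] := best L1; exists y'; split=> //; left.
    by apply: le_lt_trans y'le _; move: lt1; rewrite /gap; lra.
  have [le2|lt2] := leP (\sum_(i in J) `|w L2 i|) (gap L2); last first.
    have [y' y'z y'le] := best L2; exists y'; split=> //; right.
    by apply: le_lt_trans y'le _; move: lt2; rewrite /gap; lra.
  by case: nJ.
have [e [e1 e2]] := balancing sumJ.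
have [b nL] := center_falsifies_antipodal e cL.
set alpha := [ffun i => _] in nL.
have holds (M : ineq R W) :
    `|\sum_i w M i * sg (e i)| <= gap M -> ineq_holds alpha M.
  rewrite ler_norml /gap => /andP[l r]; rewrite ineq_holds_centered.
  rewrite (bigID (fun i => i.1 \in S)) /=.
  rewrite (eq_bigr (fun i => M.1 i * sg (y i))) => [|i iS]; last first.
    by rewrite ffunE iS.
  have wE : \sum_i w M i * sg (e i) = \sum_(i | i.1 \notin S) M.1 i * sg (e i).
    rewrite (bigID (fun i => i.1 \in S)) /= big1 ?add0r => [|i iS].
      by apply: eq_bigr => i iS; rewrite /w (negPf iS).
    by rewrite /w iS mul0r.
  have : \sum_(i | i.1 \notin S) M.1 i * sg (alpha i) =
      sg (~~ b) * \sum_i w M i * sg (e i).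
    rewrite wE mulr_sumr; apply: eq_bigr => i iS.
    rewrite ffunE (negPf iS); case: (b); rewrite ?addbT ?addbF ?sgN /=; ring.
  move=> ->; case: (b) => /=; lra.
by move: nL; rewrite imp ?holds.
Qed.
End Step.

(** * Simulation of the refutation by queries *)

Section Simulation.
Variables (R : realDomainType) (V : finType) (F : cnf V).
Local Notation W := (V * 'I_4)%type.

(** The values at the all-true and all-false points average to the value at the center. *)
Lemma ineq_unsat_center (y : assignment W) (L : ineq R W) :
  ineq_unsat L -> center_falsifies set0 y L.
Proof.
move=> nL; rewrite /center_falsifies big_pred0 => [|i]; last by rewrite inE.
have sumE b : \sum_i L.1 i * sg ([ffun=> b : bool] i) = sg b * \sum_i L.1 i.
  by rewrite mulr_sumr; apply: eq_bigr => i _; rewrite ffunE mulrC.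
have := nL [ffun=> true]; have := nL [ffun=> false].
by rewrite !ineq_holds_centered -!ltNge !sumE /=; lra.
Qed.

(** Bounds on variables hold at every point, so only clause inequalities can fail at a center. *)
Lemma scp_input_center (S : {set V}) (y : assignment W) (L : ineq R W) :
  scp_input (xor4 F) L -> center_falsifies S y L ->
  exists2 C, C \in F & C \subset falsified_clause S (block_parity y).
Proof.
have pointE (a : W -> R) (w : W) (alpha : assignment W) :
    \sum_v a v * (v == w)%:R * (alpha v)%:R = a w * (alpha w)%:R.
  rewrite (bigD1 w) //= eqxx mulr1 big1 ?addr0 // => v /negPf ->.
  by rewrite mulr0 mul0r.
case=> [w|w|D] => [cL|cL|/bigcupP[C CF /imsetP[c]]].
- have [b /negP[]] := center_falsifies_antipodal (fun=> true) cL.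
  rewrite /ineq_holds /=.
  under eq_bigr do rewrite ffunE -[(_ == _)%:R]mul1r.
  by rewrite (pointE (fun=> 1)) mul1r ler0n.
- have [b /negP[]] := center_falsifies_antipodal (fun=> true) cL.
  rewrite /ineq_holds /=.
  under eq_bigr do rewrite ffunE -mulN1r.
  by rewrite (pointE (fun=> - 1)) mulN1r lerN2 lern1 leq_b1.
rewrite inE => /forall_inP cP -> cL; exists C => //.
apply/subsetP=> -[v b] lC.
have [/andP[vS /eqP yv]|nv] := boolP ((v \in S) && (block_parity y v == ~~ b)).
  by apply/imsetP; exists v => //; rewrite yv negbK.
(* If the fixed blocks did not falsify [(v, b)], some falsifying point would have parity [b] on
   block [v] and so satisfy the clause chosen for that literal. *)
pose z u := if u == v then b else block_parity y u.
have [|alpha] := center_falsifies_parity (z := z) cL.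
  move=> u uS; rewrite /z; case: eqP => // uv; move: nv.
  by rewrite -uv uS /=; case: (block_parity y u) b {lC z} => [] [].
rewrite clause_ineqE => /existsP nalpha az; case: nalpha.
have /imsetP[s] := cP _ lC; rewrite inE /= => sb cE.
have : clause_sat alpha (c (v, b)).
  rewrite cE exclude_blockE; apply: contraNneq sb => <-.
  by have := az v; rewrite /z eqxx /block_parity => ->.
case/existsP=> l /andP[lc al]; exists l; rewrite al andbT.
by apply/bigcupP; exists (v, b).
Qed.

Lemma scp_refutation_depth_Res (pi : derivation (ineq R W)) :
  unsat F -> scp_refutation (xor4 F) pi -> (depth_Res F <= (dag_depth pi).*2)%N.
Proof.
move=> uF [vpi [k0 k0_unsat]]; set d := dag_depth pi.
(* The path [p] from [k0] to the current line measures the depth already spent; two queries are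
   allowed for each remaining edge. *)
suff sim n (k : 'I_(dsize pi)) p : (k < n)%N -> path (@dag_edge _ pi) k0 p ->
    last k0 p = k -> forall S y, center_falsifies S y (line k) ->
    derivable_within F d.*2 (d - size p).*2 (falsified_clause S (block_parity y)).
  pose y0 : assignment W := [ffun=> false].
  have := sim _ k0 [::] (ltnSn k0) isT erefl set0 y0 (ineq_unsat_center y0 k0_unsat).
  by rewrite /falsified_clause imset0; apply: derivable_within_refutation.
elim: n k p => // n IH k p lt_kn k0p lastp S y cL.
have [lt_k inf] := vpi k.
have premP j : j \in prem k ->
    (size p < d)%N /\ forall S' y', center_falsifies S' y' (line j) ->
    derivable_within F d.*2 (d - (size p).+1).*2
      (falsified_clause S' (block_parity y')).
  move=> jk; have k0pj : path (@dag_edge _ pi) k0 (rcons p j).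
    by rewrite rcons_path k0p lastp.
  split; first by have := path_dag_depth vpi k0pj; rewrite size_rcons.
  move=> S' y' cj; rewrite -(size_rcons p j); apply: (IH j) => //.
    by apply: leq_trans (allP lt_k j jk) _; rewrite -ltnS.
  by rewrite last_rcons.
have [inp|[]] : scp_input (xor4 F) (line k) \/ (size (prem k) <= 2)%N /\
    forall alpha, all (fun j => ineq_holds alpha (line j)) (prem k) ->
      ineq_holds alpha (line k).
  move: inf; move: (line k) => L; move def_ps: [seq _ | _ <- _] => ps inf.
  case: inf def_ps => [L' inp _|ps' L' sz imp def_ps]; first by left.
  right; split; first by rewrite -(size_map (@line _ pi)) def_ps.
  by move=> alpha sat; apply: imp; rewrite -def_ps all_map.
- have [C CF Cy] := scp_input_center inp cL.
  exact: derivable_within_input CF Cy.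
move=> sz imp.
have [j1 [j2 [/premP[lt_d d1] /premP[_ d2] imp12]]] : exists j1 j2,
    [/\ j1 \in prem k, j2 \in prem k & forall alpha, ineq_holds alpha (line j1) ->
      ineq_holds alpha (line j2) -> ineq_holds alpha (line k)].
  (* With no premise the line would hold everywhere, though it fails at a point; a single premise is
     used twice. *)
  case: (prem k) sz imp => [|j1 [|j2 [|//]]] _ /= imp.
  - have [b /negP[]] := center_falsifies_antipodal (fun=> true) cL.
    exact: imp.
  - by exists j1, j1; rewrite inE eqxx; split=> // alpha h1 _; rewrite imp ?h1.
  - exists j1, j2; rewrite !inE !eqxx orbT; split=> // alpha h1 h2.
    by rewrite imp ?h1 ?h2.
have [T T2 stepT] := center_falsifies_step cL imp12.
apply: (@derivable_within_leq _ _ _ ((d - (size p).+1).*2 + #|T|)); first lia.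
apply: derivable_within_queries => [|z zy]; first lia.
have [|y' [y'z cy']] := stepT z; first by move=> v vS; rewrite zy.
suff -> : falsified_clause (S :|: T) z =
    falsified_clause (S :|: T) (block_parity y').
  by case: cy' => [/d1|/d2].
by apply: eq_in_imset => v vST; rewrite y'z.
Qed.
End Simulation.

Theorem theorem5p5 (R : realDomainType) (n : nat) (F : cnf 'I_n) :
  unsat F ->
  ((depth_sCP R (xor4 F))%:R >= 2^-1 * (depth_Res F)%:R :> rat)%R.
Proof.
move=> uF; have [[pi pi_ref <-] _] := depth_sCPP (xor4_unsat uF) R.
rewrite mulrC ler_pdivrMr // -natrM ler_nat muln2.
exact: scp_refutation_depth_Res pi_ref.
Qed.
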